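(* There exist absolute constants $c_1,c_2,c_3>0$ such that for all integers $b\ge1$ and $\ell\ge1$ the graph $G_{b,\ell}$ satisfies: (i) $2^{b\ell+c_1(b+\log\ell)}\le|V(G_{b,\ell})|\le 2^{b\ell+c_2(b+\log \ell)}$; (ii) $G_{b,\ell}$ has maximum degree $3$; (iii) every hub labeling $\{S_v\}$ of $G_{b,\ell}$ satisfies $\frac{1}{|V(G_{b,\ell})|}\sum_{v\in V(G_{b,\ell})}|S_v|\ge 2^{b\ell-c_3(b+\ell)}$.
   Context: Notation $[a,b]=\{a,a+1,\dots,b\}$. Fix integers $b,\ell\ge1$, set $s=2^b$ and $A=3\ell s^2$. The weighted graph $H_{b,\ell}$ has vertex set $V=\bigcup_{i=0}^{2\ell}V_i$ with $V_i=\{v_{i,\vec j}:\vec j\in[0,s-1]^\ell\}$. For $i\in[0,2\ell-1]$ let $c(i)=i+1$ if $i<\ell$ and $c(i)=2\ell-i$ if $i\ge\ell$. There is an edge between $v_{i,\vec j}$ and $v_{i+1,\vec j'}$ iff $j_k=j'_k$ for all $k\ne c(i)$ (so $\vec j,\vec j'$ may differ only in coordinate $c=c(i)$), with weight $A+(j_c-j'_c)^2$; there are no other edges. The unweighted graph $G_{b,\ell}$ is obtained from $H_{b,\ell}$ as follows: every vertex $v\in V_i$ is kept, and gets attached (root adjacent to $v$) a complete binary tree $T^{\mathrm{in}}_v$ of depth $b$ with $s$ leaves, present only if $i>0$, whose leaves are labeled $v^{\mathrm{in}}_u$ for the $s$ neighbors $u\in V_{i-1}$ of $v$ in $H_{b,\ell}$,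 and a complete binary tree $T^{\mathrm{out}}_v$ of depth $b$ with $s$ leaves, present only if $i<2\ell$, whose leaves are labeled $v^{\mathrm{out}}_u$ for the $s$ neighbors $u\in V_{i+1}$ of $v$; all trees are disjoint. For every edge $e=\{u,v\}$ of $H_{b,\ell}$ with $u\in V_i,v\in V_{i+1}$, the leaves $u^{\mathrm{out}}_v$ and $v^{\mathrm{in}}_u$ are joined by a path of length $w(e)-2b-2$ through new auxiliary vertices (so that the $u$–$v$ route through the gadget has length $w(e)$). A hub labeling of a graph is a family of sets $S_v\subseteq V$ such that for every pair $u,v$ at finite distance there is $w\in S_u\cap S_v$ with $\mathrm{dist}(u,w)+\mathrm{dist}(w,v)=\mathrm{dist}(u,v)$. *)

(* Defs.v *)
From Stdlib Require Import Reals.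
From mathcomp Require Import all_boot.
Set Implicit Arguments. Unset Strict Implicit. Unset Printing Implicit Defensive.

Fixpoint walk (T : finType) (e : rel T) (n : nat) (u v : T) : bool :=
  match n with
  | 0 => u == v
  | n'.+1 => [exists w, e u w && walk e n' w v]
  end.

Definition isdist (T : finType) (e : rel T) (u v : T) (d : nat) : Prop :=
  walk e d u v /\ forall m, m < d -> ~~ walk e m u v.

Definition hub_labeling (T : finType) (e : rel T) (Vs : {set T})
    (S : T -> {set T}) : Prop :=
  (forall v, v \in Vs -> S v \subset Vs) /\
  forall u v, u \in Vs -> v \in Vs -> (exists n, walk e n u v) ->
    exists w, [/\ w \in S u, w \in S v &
      exists d1 d2 d, [/\ isdist e u w d1, isdist e w v d2,
                          isdist e u v d & d1 + d2 = d]].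

Definition sz (b : nat) := 2 ^ b.
Definition AA (b l : nat) := 3 * l * (sz b) ^ 2.

Definition J (b l : nat) := {ffun 'I_l -> 'I_(sz b)}.

(* c(i), 1-indexed coordinate, for i in [0,2l-1] *)
Definition cc (l i : nat) : nat := if i < l then i.+1 else 2 * l - i.
Definition ci (l i : nat) : nat := (cc l i).-1.

Definition coord (b l : nat) (j : J b l) (k : nat) : nat :=
  if @insub _ (fun t => t < l) _ k is Some t then val (j t) else 0.
Definition upd (b l : nat) (j : J b l) (k : nat) (q : 'I_(sz b)) : J b l :=
  [ffun t => if val t == k then q else j t].

Definition sqdiff (a q : nat) := (maxn a q - minn a q) ^ 2.

(* weight of the H-edge from v_{i,j} to v_{i+1,j'} where j' = j with
   coordinate c(i) set to q *)
Definition wt (b l : nat) (i : nat) (j : J b l) (q : nat) : nat :=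
  AA b l + sqdiff (coord j (ci l i)) q.
(* length of the connecting path between the two leaves *)
Definition plen (b l i : nat) (j : J b l) (q : nat) : nat :=
  wt i j q - 2 * b - 2.

(* Vertex type:
   - inl (inl (i, j))           : main vertex v_{i,j}, i in [0,2l]
   - inl (inr (o,i,j,d,p))      : node of tree T^out_{v_{i,j}} (o = true) or
                                  T^in_{v_{i,j}} (o = false), at depth d in [0,b]
                                  (root: depth 0), position p < 2^d; children of
                                  (d,p) are (d+1,2p),(d+1,2p+1). The leaf at
                                  position p is labelled by the H-neighbour
                                  whose coordinate c(i) (out) resp. c(i-1) (in)
                                  equals p.
   - inr (i,j,q,k)              : k-th internal vertex (1 <= k <= len-1) of the
                                  path for the H-edge {v_{i,j}, v_{i+1,upd j (c(i)) q}}. *)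
Definition GV (b l : nat) : finType :=
  (('I_(2 * l + 1) * J b l)
   + (bool * 'I_(2 * l + 1) * J b l * 'I_b.+1 * 'I_(sz b))
   + ('I_(2 * l) * J b l * 'I_(sz b) * 'I_(AA b l + sz b * sz b)))%type.

Definition gvalid (b l : nat) (x : GV b l) : bool :=
  match x with
  | inl (inl _) => true
  | inl (inr (o, i, j, d, p)) =>
      [&& (o ==> (val i < 2 * l)), (~~ o ==> (0 < val i)) & val p < 2 ^ val d]
  | inr (i, j, q, k) => (1 <= val k) && (val k <= (plen (val i) j (val q)).-1)
  end.

Definition gadj0 (b l : nat) (x y : GV b l) : bool :=
  match x, y with
  | inl (inl (i, j)), inl (inr (o, i', j', d, p)) =>
      [&& i == i', j == j', val d == 0 & val p == 0]
  | inl (inr (o, i, j, d, p)), inl (inr (o', i', j', d', p')) =>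
      [&& o == o', i == i', j == j', val d' == (val d).+1 &
          (val p' == 2 * val p) || (val p' == (2 * val p).+1)]
      || [&& o, ~~ o', val i' == (val i).+1, j' == upd j (ci l (val i)) p,
             val d == b, val d' == b, val p' == coord j (ci l (val i)) &
             plen (val i) j (val p) == 1]
  | inl (inr (o, i, j, d, p)), inr (i', j', q, k) =>
      [&& o, val i == val i', j == j', val d == b, p == q & val k == 1]
  | inr (i, j, q, k), inr (i', j', q', k') =>
      [&& i == i', j == j', q == q' & val k' == (val k).+1]
  | inr (i, j, q, k), inl (inr (o, i', j', d, p)) =>
      [&& ~~ o, val i' == (val i).+1, j' == upd j (ci l (val i)) q,
          val d == b, val p == coord j (ci l (val i)) &
          val k == (plen (val i) j (val q)).-1]
  | _, _ => false
  end.

Definition Gadj (b l : nat) : rel (GV b l) :=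
  fun x y => [&& gvalid x, gvalid y & gadj0 x y || gadj0 y x].

Definition Vset (b l : nat) : {set GV b l} := [set x | gvalid x].
Definition nV (b l : nat) : nat := #|Vset b l|.
Definition gdeg (b l : nat) (x : GV b l) : nat := #|[set y | Gadj x y]|.
Definition maxdeg (b l : nat) : nat := \max_(x in Vset b l) gdeg x.

Definition log2 (x : R) : R := Rdiv (ln x) (ln (IZR 2)).

(* Main.v *)
Require Import Defs.
From Stdlib Require Import Reals Lra.
From mathcomp Require Import all_boot order ssralg ssrnum ssrint zify ring.
Set Implicit Arguments. Unset Strict Implicit. Unset Printing Implicit Defensive.

(** Let x and z be vectors whose coordinates have equal parities, and put
delta = (z - x) / 2.  On the main vertices define
  phi(v_{i,j}) = i A + sum_k (2 delta_k j_k - n_{i,k} delta_k^2),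
where n_{i,k} counts the levels below i at which coordinate k may move.  Along
an edge from level i to level i+1 the slack w - (phi(v') - phi(u)) is the
perfect square (j'_c - j_c - delta_c)^2, and A is so large that phi never grows
by the weight of an edge traversed downwards.  Hence phi, extended to the
gadgets, is 1-Lipschitz, and a walk from v_{0,x} along which it grows by 1 at
each step meets only main vertices v_{i,j} with j = x + n_i delta.  A hub w of
v_{0,x} and v_{2l,z} is reached by such a walk, so that it reveals x + n_i delta
for its level i.  If i >= l then every n_{i,k} >= 1 and (x, w) determines delta;
if i <= l then every n_{i,k} <= 1 and (z, w) determines delta.  The number of
pairs (x, z), 2^(2bl - l), is therefore at most the sum of the |S_v|. *)

(** * Concatenation and reversal of walks *)

Section Walks.
Variables (T : finType) (e : rel T).

Lemma walk_cat m n u v w : walk e m u v -> walk e n v w -> walk e (m + n) u w.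
Proof.
elim: m u => [|m IH] u /=; first by move/eqP->.
case/existsP=> u' /andP[uu' u'v] vw; apply/existsP; exists u'.
by rewrite uu' IH.
Qed.

Lemma walk1 u v : e u v -> walk e 1 u v.
Proof. by move=> uv; apply/existsP; exists v; rewrite uv /=. Qed.

Lemma walk_sym n u v : symmetric e -> walk e n u v -> walk e n v u.
Proof.
move=> e_sym; elim: n u => [|n IH] u; first by rewrite /= eq_sym.
case/existsP=> u' /andP[uu' /IH vu'].
by rewrite -[n.+1]addn1; apply: (walk_cat vu'); apply: walk1; rewrite e_sym.
Qed.
End Walks.

(** * Arithmetic behind the upper bound on the number of vertices *)

Lemma vertex_count_le (X b l s : nat) : 0 < l -> 0 < b < s ->
  (2 * l + 1) * X + 2 * (2 * l + 1) * X * b.+1 * s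
    + 2 * l * X * s * (3 * l * s ^ 2 + s * s) <= X * (s * l) ^ 8.
Proof.
move=> l_gt0 /andP[b_gt0 lt_bs]; pose u := s * l; rewrite -/u.
have le_su : s <= u by rewrite leq_pmulr.
have le_lu : 2 * l <= u by rewrite leq_mul2r; lia.
have u_gt1 : 1 < u by lia.
(* The three summands cost at most 2, 4 and 8 times [X * u ^ 4], 14 in all, and [2 ^ 4 <= u ^ 4]. *)
apply: (@leq_trans (X * (2 ^ 4 * u ^ 4))); last first.
  by rewrite leq_mul2l (expnD u 4 4) leq_mul2r leq_exp2r // u_gt1 !orbT.
have h1 : 2 * l + 1 <= 2 * u ^ 4.
  have : u ^ 1 <= u ^ 4 by rewrite leq_exp2l.
  by rewrite expn1; lia.
have u3 : u * (u * u) <= u ^ 4 by rewrite -[u * (u * u)]/(u ^ 3) leq_exp2l.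
have h2 : (2 * l + 1) * (b.+1 * s) <= 2 * u ^ 4.
  apply: leq_trans (_ : 2 * u * (u * u) <= _); last by lia.
  by apply: leq_mul; [|apply: leq_mul]; lia.
have h3 : (l * s) * (l * s * s) <= u ^ 4.
  apply: leq_trans u3; rewrite [l * s]mulnC -/u leq_mul2l leq_mul2l le_su.
  by rewrite !orbT.
apply: (@leq_trans (X * ((2 * l + 1) + 2 * ((2 * l + 1) * (b.+1 * s))
                         + 8 * ((l * s) * (l * s * s))))).
  have h5 : 3 * l * s ^ 2 + s * s <= 4 * (l * s * s).
    by rewrite -mulnn; have : s * s <= l * (s * s) by [rewrite leq_pmull]; lia.
  apply: leq_trans (leq_add (leqnn _) (leq_mul (leqnn _) h5)) _.
  by rewrite eq_leq //; ring.
by rewrite leq_mul2l; apply/orP; right; lia.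
Qed.

(** * Path lengths and adjacency in the gadget graph *)

Section Graph.
Variables b l : nat.
Hypotheses (b_gt0 : 0 < b) (l_gt0 : 0 < l).
Notation GV := (GV b l).
Notation J := (J b l).
Implicit Types (j : J) (x y : GV).

Definition mainv (i : 'I_(2 * l + 1)) j : GV := inl (inl (i, j)).
Definition treev o (i : 'I_(2 * l + 1)) j (d : 'I_b.+1) (p : 'I_(sz b)) : GV :=
  inl (inr (o, i, j, d, p)).
Definition pathv (i : 'I_(2 * l)) j (q : 'I_(sz b)) k : GV := inr (i, j, q, k).

Lemma ci_lt i : i < 2 * l -> ci l i < l.
Proof. by rewrite /ci /cc; case: ifP; lia. Qed.

Lemma coordE j k (lt_kl : k < l) : coord j k = j (Ordinal lt_kl).
Proof. by rewrite /coord insubT. Qed.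

Lemma sqdiff_lt j k (q : 'I_(sz b)) : sqdiff (coord j k) q < sz b * sz b.
Proof.
have jk_lt : coord j k < sz b.
  by rewrite /coord; case: insubP => [t _ _|_]; [exact: ltn_ord | rewrite /sz expn_gt0].
rewrite /sqdiff -mulnn; have := ltn_ord q; nia.
Qed.

Lemma sz_gt : b < sz b. Proof. exact: ltn_expl. Qed.

(** Follows from [b < sz b]. It makes the truncated subtraction in [plen] exact, gives every
    connecting path an inner vertex, and supplies the margin in [main_potential_gt]. *)
Lemma AA_large : 4 * b + 6 <= AA b l.
Proof. by rewrite /AA -mulnn; have := sz_gt; nia. Qed.

Lemma plenK i j q : plen i j q + (2 * b + 2) = wt i j q.
Proof. by rewrite /plen /wt; have := AA_large; lia. Qed.

Lemma plen_gt1 i j q : 1 < plen i j q.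
Proof. by have := plenK i j q; rewrite /wt; have := AA_large; lia. Qed.

Lemma plen_lt i j (q : 'I_(sz b)) : plen i j q < AA b l + sz b * sz b.
Proof. by have := plenK i j q; rewrite /wt; have := sqdiff_lt j (ci l i) q; lia. Qed.

Lemma Gadj_sym : symmetric (@Gadj b l).
Proof. by move=> x y; rewrite /Gadj andbCA orbC. Qed.

(* The leaf-to-leaf case of [gadj0] is left out: it needs a connecting path of
   length 1, but [1 < plen i j q]. *)
Inductive arc : GV -> GV -> Prop :=
| ArcRoot o i j (d : 'I_b.+1) (p : 'I_(sz b)) : d = 0 :> nat -> p = 0 :> nat ->
    arc (mainv i j) (treev o i j d p)
| ArcChild o i j (d d' : 'I_b.+1) (p p' : 'I_(sz b)) :
    d' = d.+1 :> nat -> (p' == 2 * p :> nat) || (p' == (2 * p).+1 :> nat) ->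
    arc (treev o i j d p) (treev o i j d' p')
| ArcOut (i : 'I_(2 * l + 1)) (i' : 'I_(2 * l)) j (d : 'I_b.+1)
     (p : 'I_(sz b)) (k : 'I_(AA b l + sz b * sz b)) :
    i = i' :> nat -> d = b :> nat -> k = 1 :> nat ->
    arc (treev true i j d p) (pathv i' j p k)
| ArcPath i j q (k k' : 'I_(AA b l + sz b * sz b)) : k' = k.+1 :> nat ->
    arc (pathv i j q k) (pathv i j q k')
| ArcIn (i : 'I_(2 * l)) (i' : 'I_(2 * l + 1)) j (q : 'I_(sz b))
     (k : 'I_(AA b l + sz b * sz b)) (d : 'I_b.+1) (p : 'I_(sz b)) :
    i' = i.+1 :> nat -> d = b :> nat -> p = coord j (ci l i) :> nat ->
    k.+1 = plen i j q :> nat ->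
    arc (pathv i j q k) (treev false i' (upd j (ci l i) q) d p).

Lemma arcP x y : reflect (arc x y) (gadj0 x y).
Proof.
apply: (iffP idP).
  case: x => [[[i j]|[[[[o i] j] d] p]]|[[[i j] q] k]];
  case: y => [[[i' j']|[[[[o' i'] j'] d'] p']]|[[[i' j'] q'] k']] //=.
  - by case/and4P=> /eqP<- /eqP<- /eqP ? /eqP ?; constructor.
  - have ->: (plen i j p == 1) = false by rewrite eqn_leq leqNgt plen_gt1.
    rewrite !andbF orbF; case/and5P=> /eqP<- /eqP<- /eqP<- /eqP ? ?.
    by constructor.
  - case/and5P=> ot /eqP ? /eqP<- /eqP ? /andP[/eqP<- /eqP ?].
    by case: o ot => // _; constructor.
  - case/and5P=> of' /eqP i'E /eqP-> /eqP d_b /andP[/eqP pE /eqP kE].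
    by case: o' of' => // _; constructor=> //; rewrite kE prednK // ltnW ?plen_gt1.
  - by case/and4P=> /eqP<- /eqP<- /eqP<- /eqP ?; constructor.
case=> //=.
- by move=> o i j d p -> ->; rewrite !eqxx.
- by move=> o i j d d' p p' -> ->; rewrite !eqxx.
- by move=> i i' j d p k -> -> ->; rewrite !eqxx.
- by move=> i j q k k' ->; rewrite !eqxx.
- by move=> i i' j q k d p -> -> -> <-; rewrite !eqxx.
Qed.

Lemma GadjP x y : reflect [/\ gvalid x, gvalid y & arc x y \/ arc y x] (Gadj x y).
Proof.
apply: (iffP and3P) => [] [-> -> xy]; split=> //.
  by case/orP: xy => /arcP; [left | right].
by apply/orP; case: xy => /arcP; [left | right].
Qed.

(** * Maximum degree *)

(** A local numbering of the edges at [x]. In a tree, 0 leads towards the main vertex and 1, 2 to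
    the children; a leaf uses 1 for its path. A main vertex uses 0 for the out-tree and 1 for the
    in-tree; a path vertex uses 0 backwards and 1 forwards. *)
Definition port (x y : GV) : nat :=
  match x, y with
  | inl (inl _), inl (inr (o, _, _, _, _)) => ~~ o
  | inl (inr (_, _, _, d, _)), inl (inr (_, _, _, d', p')) =>
      if d' < d then 0 else (odd p').+1
  | inl (inr _), inr _ => 1
  | inr (_, _, _, k), inr (_, _, _, k') => if k' < k then 0 else 1
  | inr _, inl (inr (o, _, _, _, _)) => ~~ o
  | _, _ => 0
  end.

Lemma port_lt3 x y : port x y < 3.
Proof.
by case: x => [[[i j]|[[[[o i] j] d] p]]|[[[i j] q] k]];
  case: y => [[[i' j']|[[[[o' i'] j'] d'] p']]|[[[i' j'] q'] k']] //=;
  try case: ifP => // _; try case: odd; try case: o'.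
Qed.

(** The position of an in-leaf stores the coordinate that [upd] overwrites, so only one connecting
    path ends there. *)
Lemma upd_inj j j' k (q q' : 'I_(sz b)) : k < l -> coord j k = coord j' k ->
  upd j k q = upd j' k q' -> j = j' /\ q = q'.
Proof.
move=> lt_kl; rewrite !(coordE _ lt_kl) => eq_k /ffunP eq_upd; split.
  apply/ffunP=> m; have := eq_upd m; rewrite !ffunE; case: eqP => // mk _.
  by apply/val_inj; rewrite (_ : m = Ordinal lt_kl) //; apply/val_inj.
by have := eq_upd (Ordinal lt_kl); rewrite !ffunE /= eqxx.
Qed.

Lemma port_inj x y y' : Gadj x y -> Gadj x y' -> port x y = port x y' -> y = y'.
Proof.
move=> /GadjP[x_ok y_ok xy] /GadjP[_ y'_ok xy'].
case: xy => xy; case: xy' => xy'; destruct xy; inversion xy'; subst => /=.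
all: try match goal with |- (nat_of_bool (~~ ?o)) = _ -> _ => try destruct o end.
all: try match goal with |- _ = (nat_of_bool (~~ ?o)) -> _ => try destruct o end.
all: rewrite /= in x_ok y_ok y'_ok.
all: repeat match goal with d : 'I_b.+1 |- _ =>
  lazymatch goal with
  | _ : is_true (nat_of_ord d < b.+1) |- _ => fail
  | _ => have := ltn_ord d; intro
  end end.
all: try case: ltnP => ?; try case: ltnP => ?; move=> Hport; try lia.
all: try by congr inl; congr inr; repeat congr pair; apply/val_inj => /=; lia.
all: try by congr inr; repeat congr pair; apply/val_inj => /=; lia.
(* The remaining case: [x] is an in-leaf, and [y], [y'] are the last inner vertices of paths ending
   at it. *)
have ii0 : i0 = i by apply/val_inj => /=; lia.
subst i0; have eq_c : coord j0 (ci l i) = coord j (ci l i) by lia.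
match goal with H : upd _ _ _ = upd _ _ _ |- _ =>
  case: (upd_inj (ci_lt (ltn_ord i)) eq_c H) => jj qq end.
by subst; congr inr; congr pair; apply/val_inj => /=; lia.
Qed.

Lemma gdeg_le3 x : gdeg x <= 3.
Proof.
rewrite /gdeg -[leqRHS](card_ord 3).
rewrite -(card_in_imset (f := fun y => Ordinal (port_lt3 x y))) ?max_card //.
by move=> y y'; rewrite !inE => xy xy' [] /port_inj ->.
Qed.

Lemma maxdegE : maxdeg b l = 3.
Proof.
apply/eqP; rewrite eqn_leq; apply/andP; split.
  by apply/bigmax_leqP => x _; apply: gdeg_le3.
have i_lt : 0 < 2 * l + 1 by rewrite addn1.
have p_lt : 1 < sz b by apply: leq_ltn_trans b_gt0 sz_gt.
pose j : J := [ffun=> Ordinal (ltnW p_lt)].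
pose T d p := treev true (Ordinal i_lt) j (inord d) p : GV.
(* The root of an out-tree attains degree 3: its main vertex and its two children, which exist
   because [0 < b]. *)
pose x := T 0 (Ordinal (ltnW p_lt)).
apply: (bigmax_sup x); first by rewrite inE /= muln_gt0 l_gt0 inordK.
pose s := [:: mainv (Ordinal i_lt) j; T 1 (Ordinal (ltnW p_lt)); T 1 (Ordinal p_lt)].
have s_uniq : uniq s by rewrite /= !inE andbT; apply/eqP=> -[].
rewrite /gdeg -[leqLHS](card_uniqP s_uniq); apply/subset_leq_card/subsetP=> y.
have b_lt : 1 < b.+1 by rewrite ltnS.
rewrite !inE; case/or3P=> /eqP->; rewrite /Gadj /= !muln_gt0 ?l_gt0 ?inordK //=;
  by rewrite !eqxx.
Qed.

(** * Tracks: the vectors met on the way between the two end levels *)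

(* For [k < l], the number of levels [i' < i] with [ci l i' = k]: these [i']
   are [k] and [2 * l - k.+1]. *)
Definition moves i k : nat := (k < i) + (2 * l - k.+1 < i).

Lemma movesS i k : k < l -> i < 2 * l -> moves i.+1 k = moves i k + (k == ci l i :> nat).
Proof.
rewrite /moves /ci /cc => lt_k lt_i.
case: (ltnP i l) => ?; case: eqP => /= ?; do 4![case: ltnP => ?] => //=; lia.
Qed.

Definition half := 2 ^ b.-1.
Definition pairs := {ffun 'I_l -> 'I_half * 'I_half * bool}.
Implicit Type t : pairs.

(* A value (a, a', e) encodes the end coordinates 2a + e and 2a' + e, with
   midpoint a + a' + e and shift a' - a. *)
Definition track_coord t i k : nat :=
  let: (a, a', e) := t k in (2 - moves i k) * a + moves i k * a' + e.

Lemma szE : sz b = 2 * half.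
Proof. by rewrite /sz /half -expnS prednK. Qed.

Lemma track_coord_lt t i k : track_coord t i k < sz b.
Proof.
rewrite /track_coord szE; case: (t k) => [[a a'] e].
have lt_a := ltn_ord a; have lt_a' := ltn_ord a'; rewrite /moves.
by case: (k < i); case: (_ - _ < i); case: e => /=; lia.
Qed.

Definition track t i : J := [ffun k => Ordinal (track_coord_lt t i k)].

(** From level [l] on, every coordinate has moved. The start 2a + e yields a and e; the coordinate
    at level i, either a + a' + e or 2a' + e, then yields a'. *)
Lemma track_inj_initial t t' i :
  l <= i -> track t 0 = track t' 0 -> track t i = track t' i -> t = t'.
Proof.
move=> le_li /ffunP eq0 /ffunP eqi; apply/ffunP=> k.
move: (eq0 k) (eqi k); rewrite !ffunE => /(congr1 val) /= + /(congr1 val) /=.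
rewrite /track_coord /moves; case: (t k) => [[a a'] e]; case: (t' k) => [[c c'] e'].
have lt_kl := ltn_ord k; rewrite ltn0 (leq_trans lt_kl) //=.
move=> H1 H2.
have [ee ac a'c']: [/\ e = e', a = c :> nat & a' = c' :> nat].
  by move: H1 H2; case: (_ < i); case: e; case: e'; split=> //=; lia.
by rewrite ee (val_inj ac) (val_inj a'c').
Qed.

(** The mirror image: up to level [l] no coordinate has moved twice. The end 2a' + e yields a' and
    e, and 2a + e or a + a' + e then yields a. *)
Lemma track_inj_final t t' i :
  i <= l -> track t (2 * l) = track t' (2 * l) -> track t i = track t' i -> t = t'.
Proof.
move=> le_il /ffunP eq0 /ffunP eqi; apply/ffunP=> k.
move: (eq0 k) (eqi k); rewrite !ffunE => /(congr1 val) /= + /(congr1 val) /=.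
rewrite /track_coord /moves; case: (t k) => [[a a'] e]; case: (t' k) => [[c c'] e'].
have lt_kl := ltn_ord k.
have [-> -> ->]: [/\ (k < 2 * l), (2 * l - k.+1 < 2 * l) & (2 * l - k.+1 < i) = false].
  by split; lia.
move=> H1 H2.
have [ee ac a'c']: [/\ e = e', a = c :> nat & a' = c' :> nat].
  by move: H1 H2; case: (k < i); case: e; case: e'; split=> //=; lia.
by rewrite ee (val_inj ac) (val_inj a'c').
Qed.

(** * The potential and its Lipschitz property *)

Section Potential.
Variable t : pairs.
Local Open Scope ring_scope.
Import GRing.Theory Num.Theory Order.TTheory.

Definition shift k : int := let: (a, a', e) := t k in (a' : nat)%:Z - (a : nat)%:Z.

Lemma shift_bound k : 4 * shift k ^+ 2 <= ((sz b)%:Z ^+ 2).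
Proof.
rewrite /shift szE; case: (t k) => [[a a'] e].
by have := ltn_ord a; have := ltn_ord a'; nia.
Qed.

Lemma track_coordS i k : (i < 2 * l)%N ->
  (track_coord t i.+1 k)%:Z = (track_coord t i k)%:Z + shift k *+ (k == ci l i :> nat).
Proof.
move=> lt_i; rewrite /track_coord /shift movesS //; case: (t k) => [[a a'] e].
(* This makes the truncated subtraction [2 - moves] exact. *)
have : (moves i.+1 k <= 2)%N by rewrite /moves; case: (k < i.+1)%N; case: (_ - _ < _)%N.
rewrite movesS //; case: eqP => _ /=; rewrite ?mulr1n ?mulr0n; nia.
Qed.

Definition main_potential (i : nat) j : int :=
  (i * AA b l)%:Z + \sum_k (2 * shift k * (j k : nat)%:Z - (moves i k)%:Z * shift k ^+ 2).

Lemma main_potentialS i j q (lt_i : (i < 2 * l)%N) (c := Ordinal (ci_lt lt_i)) :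
  main_potential i.+1 (upd j (ci l i) q)
  = main_potential i j + (AA b l)%:Z
    + 2 * shift c * ((q : nat)%:Z - (j c : nat)%:Z) - shift c ^+ 2.
Proof.
rewrite /main_potential (bigD1 c) //= [in RHS](bigD1 c) //= ffunE eqxx movesS ?ci_lt //= eqxx.
rewrite (eq_bigr (fun k : 'I_l =>
    2 * shift k * (j k : nat)%:Z - (moves i k)%:Z * shift k ^+ 2)).
  by rewrite mulSn !PoszD (_ : Posz true = 1) //; ring.
move=> k; rewrite -val_eqE /= => /negPf kc; rewrite ffunE kc movesS // kc.
by rewrite addn0.
Qed.

Lemma wtE i j (q : 'I_(sz b)) (lt_i : (i < 2 * l)%N) (c := Ordinal (ci_lt lt_i)) :
  (wt i j q)%:Z = (AA b l)%:Z + ((q : nat)%:Z - (j c : nat)%:Z) ^+ 2.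
Proof.
rewrite /wt /sqdiff (coordE j (ci_lt lt_i)) -/c PoszD; congr (_ + _).
by case: (leqP (j c) q) => ?; rewrite -mulnn; nia.
Qed.

Lemma main_potential_le i j (q : 'I_(sz b)) : (i < 2 * l)%N ->
  main_potential i.+1 (upd j (ci l i) q) <= main_potential i j + (wt i j q)%:Z.
Proof.
move=> lt_i; rewrite main_potentialS wtE; set c := Ordinal _; set D := (q : nat)%:Z - _.
by have := sqr_ge0 (D - shift c); nia.
Qed.

Lemma main_potential_eq i j (q : 'I_(sz b))
    (lt_i : (i < 2 * l)%N) (c := Ordinal (ci_lt lt_i)) :
  main_potential i.+1 (upd j (ci l i) q) = main_potential i j + (wt i j q)%:Z <->
  (q : nat)%:Z = (j c : nat)%:Z + shift c.
Proof.
rewrite main_potentialS wtE -/c; split=> [H|->]; last by ring.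
suff /eqP: ((q : nat)%:Z - (j c : nat)%:Z - shift c) ^+ 2 = 0.
  by rewrite sqrf_eq0 subr_eq0 subr_eq addrC => /eqP.
by nia.
Qed.

(** Completing the square, the potential difference plus the weight is 2A + (D + shift)^2 - 2
    shift^2, where 2 shift^2 <= s^2 / 2 <= A / 2. The margin 4b + 4 counts 2b + 2 twice: for the
    offset of the two leaf potentials and for the gap between [wt] and [plen]. *)
Lemma main_potential_gt i j (q : 'I_(sz b)) : (i < 2 * l)%N ->
  main_potential i j + (4 * b + 4)%:Z < main_potential i.+1 (upd j (ci l i) q) + (wt i j q)%:Z.
Proof.
move=> lt_i; rewrite main_potentialS wtE; set c := Ordinal _; set D := (q : nat)%:Z - _.
have := sqr_ge0 (D + shift c); have := shift_bound c.
have : (4 * b + 6 <= AA b l)%N by apply: AA_large.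
have : (sz b ^ 2 <= AA b l)%N by rewrite /AA; nia.
rewrite -mulnn; nia.
Qed.

(* Both expressions in the [max] have slope 1 in absolute value and they fit the
   two end leaves. With [max] instead of [min], the first step of the path is an
   increase only if the whole [H]-edge is tight. *)
Definition potential x : int :=
  match x with
  | inl (inl (i, j)) => main_potential i j
  | inl (inr (o, i, j, d, p)) =>
      if o then main_potential i j + (d : nat).+1%:Z else main_potential i j - (d : nat).+1%:Z
  | inr (i, j, q, k) =>
      Num.max (main_potential i j + b.+1%:Z - (k : nat)%:Z)
              (main_potential i.+1 (upd j (ci l i) q) - b.+1%:Z - (plen i j q)%:Z
                 + (k : nat)%:Z)
  end.

(** A path vertex needs both ends of its edge on the track, so leaving a path at either end
    preserves the condition and only entering one needs an argument. *)
Definition on_track x : bool :=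
  match x with
  | inl (inl (i, j)) => j == track t i
  | inl (inr (o, i, j, d, p)) => j == track t i
  | inr (i, j, q, k) => (j == track t i) && (upd j (ci l i) q == track t i.+1)
  end.

Lemma upd_track i (q : 'I_(sz b)) (lt_i : (i < 2 * l)%N) (c := Ordinal (ci_lt lt_i)) :
  (q : nat)%:Z = (track t i c : nat)%:Z + shift c ->
  upd (track t i) (ci l i) q = track t i.+1.
Proof.
rewrite ffunE /= => qE; apply/ffunP=> k; rewrite !ffunE; apply/val_inj => /=.
case: eqP => [kc|/eqP/negPf kc]; last first.
  by have := @track_coordS i k lt_i; rewrite kc mulr0n addr0 => -[->].
have <- : c = k by apply/val_inj.
by have := @track_coordS i c lt_i; rewrite /= eqxx mulr1n -qE => -[->].
Qed.

Lemma potential_arc x y : arc x y ->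
  [/\ potential y <= potential x + 1, potential x <= potential y + 1,
      on_track x -> potential y = potential x + 1 -> on_track y
    & on_track y -> potential x = potential y + 1 -> on_track x].
Proof.
case=> /=.
- by move=> o i j d p -> _; case: o; split=> //; lia.
- by move=> o i j d d' p p' -> _; case: o; split=> //; lia.
- move=> i i' j d p k ii' -> ->; have lt_i := ltn_ord i'.
  have := main_potential_le j p lt_i; have := main_potential_gt j p lt_i; have := plenK i' j p.
  have := main_potential_eq j p lt_i; set B := main_potential i'.+1 _; rewrite ii'.
  set A := main_potential i' _ => AB.
  move=> H1 H2 H3; split; [lia | lia | | by case/andP].
  (* The first term of the [max] lies below the value at the leaf, so an increase must come from the
     second term, which means zero slack. *)
  move=> /eqP jE H; have qE : B = A + (wt i' j p)%:Z by lia.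
  by move/AB: qE; rewrite jE eqxx => /upd_track->; rewrite eqxx.
- move=> i j q k k' ->; split=> //; lia.
- move=> i i' j q k d p i'E -> _ kE; have lt_i := ltn_ord i.
  have := main_potential_le j q lt_i; have := main_potential_gt j q lt_i; have := plenK i j q.
  rewrite i'E; set B := main_potential i.+1 _; set A := main_potential i _.
  (* The last claim is vacuous: since [main_potential_gt] is strict, the potential never rises by 1
     from an in-leaf into its path. *)
  move=> H1 H2 H3; split; [lia | lia | by case/andP | lia].
Qed.

(** Each step gains at most 1, so a total gain of [n] makes every step an increase, and the track is
    never left. *)
Lemma potential_walk n x y : walk (@Gadj b l) n x y ->
  potential y <= potential x + n%:Z
  /\ (on_track x -> potential y = potential x + n%:Z -> on_track y).
Proof.
elim: n x => [|n IH] x /=; first by move/eqP->; split=> //; lia.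
case/existsP=> x' /andP[/GadjP[_ _ xx'] /IH[le_y inv_y]].
have [le_x' inv_x']: potential x' <= potential x + 1
    /\ (on_track x -> potential x' = potential x + 1 -> on_track x').
  by case: xx' => /potential_arc[].
split=> [|inv_x yE]; first by lia.
by apply: inv_y; [apply: inv_x' => //|]; lia.
Qed.
End Potential.

(** * Walks through the gadgets and along a track *)

Lemma walk_tree o i j (d : 'I_b.+1) (p : 'I_(sz b)) :
  gvalid (treev o i j d p) -> walk (@Gadj b l) d.+1 (mainv i j) (treev o i j d p).
Proof.
move Ed: (nat_of_ord d) => n; elim: n d p Ed => [|n IH] d p Ed ok;
  have /and3P[o1 o2 lt_p] := ok; rewrite /= Ed in lt_p.
  apply: walk1; apply/GadjP; split=> //; left; constructor=> //.
  by move: lt_p; rewrite expn0; lia.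
have lt_d := ltn_ord d.
have p2_lt : p %/ 2 < sz b by apply: leq_ltn_trans (leq_div _ _) (ltn_ord p).
have d'E : (inord n : 'I_b.+1) = n :> nat by rewrite inordK //; lia.
pose u := treev o i j (inord n) (Ordinal p2_lt).
have u_ok : gvalid u by rewrite /u /= o1 o2 d'E ltn_divLR // -expnSr.
rewrite -[n.+2]addn1; apply: walk_cat (IH _ _ d'E u_ok) _.
apply: walk1; apply/GadjP; split=> //; left; constructor; first by rewrite d'E.
by rewrite /=; lia.
Qed.

Lemma walk_path (i : 'I_(2 * l)) (i' : 'I_(2 * l + 1)) j (q : 'I_(sz b))
    (k : 'I_(AA b l + sz b * sz b)) :
  i' = i :> nat -> gvalid (pathv i j q k) ->
  walk (@Gadj b l) k (treev true i' j ord_max q) (pathv i j q k).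
Proof.
move=> i'E; move Ek: (nat_of_ord k) => n; elim: n k Ek => [|n IH] k Ek ok;
  have lt_k := ok; rewrite /= Ek // in lt_k; case: (posnP n) => [n0|n_gt0].
  rewrite n0; apply: walk1; apply/GadjP; split=> //.
    by rewrite /= i'E !ltn_ord.
  by left; constructor; rewrite // Ek n0.
have n_lt : n < AA b l + sz b * sz b by have := ltn_ord k; lia.
have ok' : gvalid (pathv i j q (Ordinal n_lt)) by rewrite /=; lia.
rewrite -[n.+1]addn1; apply: walk_cat (IH _ _ ok') _ => //.
by apply: walk1; apply/GadjP; split=> //; left; constructor.
Qed.

Lemma walk_edge i (i1 i2 : 'I_(2 * l + 1)) j (q : 'I_(sz b)) :
  i < 2 * l -> i1 = i :> nat -> i2 = i.+1 :> nat ->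
  walk (@Gadj b l) (wt i j q) (mainv i1 j) (mainv i2 (upd j (ci l i) q)).
Proof.
move=> lt_i i1E i2E; have lt_c := ci_lt lt_i.
pose p := j (Ordinal lt_c).
have n_gt1 := plen_gt1 i j q.
have k_lt : (plen i j q).-1 < AA b l + sz b * sz b.
  by have := plen_lt i j q; lia.
pose k := Ordinal k_lt.
have ok_k : gvalid (pathv (Ordinal lt_i) j q k) by rewrite /= leqnn andbT; lia.
have ok1 : gvalid (treev true i1 j ord_max q) by rewrite /= i1E lt_i ltn_ord.
have ok2 : gvalid (treev false i2 (upd j (ci l i) q) ord_max p).
  by rewrite /= i2E ltn_ord.
(* Down the out-tree, along the path to its last inner vertex, one step to the in-leaf, and up the
   in-tree. *)
rewrite (_ : wt i j q = b.+1 + k + 1 + b.+1); last first.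
  by rewrite -plenK /=; lia.
apply: walk_cat (walk_sym Gadj_sym (walk_tree ok2)).
apply: walk_cat (walk_cat (walk_tree ok1) (walk_path _ ok_k)) _ => //.
apply: walk1; apply/GadjP; split=> //; left; constructor=> //=.
  by rewrite (coordE _ lt_c).
by rewrite prednK //; lia.
Qed.

(** Every edge of the track has zero slack, so the potential grows by exactly the length walked. *)
Lemma walk_track t n (i0 i : 'I_(2 * l + 1)) : i0 = 0 :> nat -> i = n :> nat ->
  exists2 m, walk (@Gadj b l) m (mainv i0 (track t 0)) (mainv i (track t n))
           & potential t (mainv i (track t n))
             = (potential t (mainv i0 (track t 0)) + m%:Z)%R.
Proof.
elim: n i => [|n IH] i i0E iE.
  exists 0; last by rewrite /= i0E iE GRing.addr0.
  by rewrite (_ : i = i0) /=; last by apply/val_inj; rewrite /= iE.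
have lt_n : n < 2 * l by have := ltn_ord i; lia.
have n_lt : n < 2 * l + 1 by lia.
have [//|//|m walk_m phi_m] := IH (Ordinal n_lt).
pose q := track t n.+1 (Ordinal (ci_lt lt_n)).
have qE : (q%:Z = (track t n (Ordinal (ci_lt lt_n)))%:Z
                  + shift t (Ordinal (ci_lt lt_n)))%R.
  by rewrite /q !ffunE /= (track_coordS t _ lt_n) /= eqxx.
have updE := upd_track qE.
exists (m + wt n (track t n) q).
  by apply: walk_cat walk_m _; rewrite -updE; apply: walk_edge.
by rewrite PoszD GRing.addrA -phi_m /= iE -updE; apply: (main_potential_eq _ _ _ lt_n).2.
Qed.

(** * Hubs lie on tracks, and counting them *)

Definition level (x : GV) : nat :=
  match x with
  | inl (inl (i, _)) => i
  | inl (inr (_, i, _, _, _)) => i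
  | inr (i, _, _, _) => i
  end.

Lemma on_track_level t t' w :
  on_track t w -> on_track t' w -> track t (level w) = track t' (level w).
Proof.
case: w => [[[i j]|[[[[o i] j] d] p]]|[[[i j] q] k]] /=; try by move=> /eqP<- /eqP.
by move=> /andP[/eqP<- _] /andP[/eqP<- _].
Qed.

Lemma hub_on_track S t (i0 i1 : 'I_(2 * l + 1))
    (u := mainv i0 (track t 0)) (v := mainv i1 (track t (2 * l))) :
  i0 = 0 :> nat -> i1 = 2 * l :> nat -> hub_labeling (@Gadj b l) (Vset b l) S ->
  exists w, [&& w \in S u, w \in S v & on_track t w].
Proof.
move=> i0E i1E [_ hub]; have [N walkN phiN] := walk_track t i0E i1E.
have [|||w [wu wv [d1 [d2 [d [[walk1 _] [walk2 _] [_ min_d] dE]]]]]] := hub u v.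
- by rewrite inE.
- by rewrite inE.
- by exists N.
exists w; rewrite wu wv /=.
have le_dN : d <= N by rewrite leqNgt; apply/negP=> /min_d; rewrite walkN.
have [le_w inv_w] := potential_walk t walk1; have [le_v _] := potential_walk t walk2.
(* The potential grows by N from [u] to [v], hence N <= d1 + d2 = d <= N, and the part up to [w]
   gains exactly d1. *)
by apply: inv_w; [rewrite /= i0E | rewrite -/u -/v in phiN; lia].
Qed.

Lemma hub_sum S : hub_labeling (@Gadj b l) (Vset b l) S ->
  (half * half * 2) ^ l <= \sum_(v in Vset b l) #|S v|.
Proof.
move=> hubS; have i0_lt : 0 < 2 * l + 1 by lia.
have i1_lt : 2 * l < 2 * l + 1 by lia.
pose u t := mainv (Ordinal i0_lt) (track t 0).
pose v t := mainv (Ordinal i1_lt) (track t (2 * l)).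
have /fin_all_exists[w wP] t := hub_on_track t (erefl : Ordinal i0_lt = 0 :> nat)
   (erefl : Ordinal i1_lt = 2 * l :> nat) hubS.
(* Each pair is charged to its hub together with the end vertex from which the level of the hub
   allows recovery of the pair. *)
pose f t := (if l <= level (w t) then u t else v t, w t).
pose D := [set xw : GV * GV | (xw.1 \in Vset b l) && (xw.2 \in S xw.1)].
have ->: \sum_(v in Vset b l) #|S v| = #|D|.
  rewrite -sum1_card (eq_bigl (fun xw => (xw.1 \in Vset b l) && (xw.2 \in S xw.1))).
    2: by move=> xw; rewrite inE.
  rewrite -(pair_big_dep (mem (Vset b l)) (fun x y => y \in S x) (fun _ _ => 1)) /=.
  by apply: eq_bigr => x _; rewrite sum1_card.
have f_inj : injective f.
  move=> t t'; rewrite /f => -[+ ww]; have /and3P[_ _ inv1] := wP t.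
  have /and3P[_ _ +] := wP t'; rewrite -ww => inv2; have := on_track_level inv1 inv2.
  case: leqP => le_l eq_pt [] eq_end; first exact: track_inj_initial le_l eq_end eq_pt.
  exact: track_inj_final (ltnW le_l) eq_end eq_pt.
rewrite (_ : _ ^ l = #|[set: pairs]|); last first.
  by rewrite cardsT card_ffun !card_prod !card_ord card_bool.
rewrite -(card_imset _ f_inj); apply/subset_leq_card/subsetP=> _ /imsetP[t _ ->].
have /and3P[wu wv _] := wP t; rewrite inE /f /=.
by case: ifP => _; rewrite inE /=.
Qed.

(** * Number of vertices, and the hub bound in powers of 2 *)

Lemma nV_lower : 2 ^ (b * l) * 2 ^ b * l <= nV b l.
Proof.
have lt1 : 1 < AA b l + sz b * sz b by rewrite /AA; have := sz_gt; nia.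
(* The first inner vertices of the connecting paths already suffice. *)
pose f (x : 'I_(2 * l) * J * 'I_(sz b)) : GV := pathv x.1.1 x.1.2 x.2 (Ordinal lt1).
have f_inj : injective f by move=> [[i j] q] [[i' j'] q'] [-> -> ->].
have : #|[set f x | x in [set: _]]| <= nV b l.
  apply/subset_leq_card/subsetP=> _ /imsetP[[[i j] q] _ ->]; rewrite inE /=.
  by have := plen_gt1 i j q; lia.
apply: leq_trans; rewrite card_imset // cardsT !card_prod card_ffun !card_ord /sz expnM.
set X := (_ ^ b) ^ l; set s := 2 ^ b; nia.
Qed.

Lemma nV_upper : nV b l <= 2 ^ (b * l) * (2 ^ b * l) ^ 8.
Proof.
apply: leq_trans (max_card _) _.
rewrite !card_sum !card_prod card_bool card_ffun !card_ord expnM.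
by apply: (vertex_count_le (sz b ^ l) l_gt0); rewrite b_gt0 sz_gt.
Qed.

(** Each coordinate has s^2 / 2 equal-parity pairs; the factor [2 ^ l] on the right clears the
    denominators. *)
Lemma hub_sum_exp S : hub_labeling (@Gadj b l) (Vset b l) S ->
  2 ^ (b * l) * 2 ^ (b * l) <= (\sum_(v in Vset b l) #|S v|) * 2 ^ l.
Proof.
move/hub_sum/leq_mul/(_ (leqnn (2 ^ l))); apply: leq_trans.
have -> : 2 ^ (b * l) = half ^ l * 2 ^ l by rewrite -expnMn [half * 2]mulnC -szE expnM.
by rewrite !expnMn mulnACA mulnA.
Qed.
End Graph.

(** * Passage to real exponents *)

Local Open Scope R_scope.

Lemma leq_INR m n : (m <= n)%N -> INR m <= INR n.
Proof. by move/leP; apply: le_INR. Qed.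

Lemma INR_exp2 n : INR (2 ^ n)%N = Rpower 2 (INR n).
Proof.
rewrite Rpower_pow; last lra.
by elim: n => [|n IH] //; rewrite expnS mult_INR IH.
Qed.

Lemma Rpower_log2 x : 0 < x -> Rpower 2 (log2 x) = x.
Proof.
move=> x_gt0; rewrite /Rpower /log2 /Rdiv Rmult_assoc Rinv_l ?Rmult_1_r ?exp_ln //.
by have := ln_lt_2; lra.
Qed.

Lemma log2_le_INR n : (0 < n)%N -> log2 (INR n) <= INR n.
Proof.
move=> n_gt0; apply: Rnot_lt_le => lt_n.
have := Rpower_lt 2 _ _ ltac:(lra) lt_n.
rewrite Rpower_log2; last by apply: lt_0_INR; apply/ltP.
by rewrite -INR_exp2; apply: Rle_not_lt; apply/leq_INR/ltnW/ltn_expl.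
Qed.

Lemma INR_vertex_scale b l c : (0 < l)%N ->
  INR (2 ^ (b * l) * (2 ^ b * l) ^ c)%N
  = Rpower 2 (INR (b * l)%N + INR c * (INR b + log2 (INR l))).
Proof.
move=> l_gt0; have lR : 0 < INR l by apply: lt_0_INR; apply/ltP.
rewrite mult_INR INR_exp2 Rpower_plus; congr Rmult.
elim: c => [|c IH]; first by rewrite Rmult_0_l Rpower_O //; lra.
rewrite expnS S_INR Rmult_plus_distr_r Rmult_1_l Rpower_plus mult_INR IH Rmult_comm.
by rewrite mult_INR INR_exp2 Rpower_plus Rpower_log2.
Qed.

Theorem theorem4 :
  exists c1 c2 c3 : R, 0 < c1 /\ 0 < c2 /\ 0 < c3 /\
  forall b l : nat, (1 <= b)%N -> (1 <= l)%N ->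
    (Rpower 2 (INR (b * l)%N + c1 * (INR b + log2 (INR l))) <= INR (nV b l) /\
     INR (nV b l) <= Rpower 2 (INR (b * l)%N + c2 * (INR b + log2 (INR l)))) /\
    maxdeg b l = 3%N /\
    (forall S : GV b l -> {set GV b l},
       hub_labeling (@Gadj b l) (Vset b l) S ->
       Rpower 2 (INR (b * l)%N - c3 * (INR b + INR l))
         <= INR (\sum_(v in Vset b l) #|S v|)%N / INR (nV b l)).
Proof.
(* 1 and 8 are the exponents of 2^b l in the vertex bounds. Dividing 2^(2bl - l) by the upper one
   leaves the exponent bl - l - 8(b + log l), which is at least bl - 9(b + l) because log l <= l. *)
exists (INR 1), (INR 8), 9; do 3![split; first by rewrite /=; lra].
move=> b l b_gt0 l_gt0.
have lower : Rpower 2 (INR (b * l)%N + INR 1 * (INR b + log2 (INR l))) <= INR (nV b l).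
  rewrite -INR_vertex_scale //; apply: leq_INR.
  by rewrite expn1 mulnA; apply: nV_lower.
have upper : INR (nV b l) <= Rpower 2 (INR (b * l)%N + INR 8 * (INR b + log2 (INR l))).
  by rewrite -INR_vertex_scale //; apply: leq_INR; apply: nV_upper.
split=> //; split=> [|S /(hub_sum_exp b_gt0 l_gt0) sum_ge]; first exact: maxdegE.
have nV_gt0 : 0 < INR (nV b l) by apply: Rlt_le_trans lower; apply: exp_pos.
have e_le : Rpower 2 (INR (b * l)%N + INR (b * l)%N)
    <= INR (\sum_(v in Vset b l) #|S v|)%N * Rpower 2 (INR l).
  by rewrite Rpower_plus -!INR_exp2 -!mult_INR; apply: leq_INR.
apply: (Rmult_le_reg_r (INR (nV b l))) => //.
rewrite /Rdiv Rmult_assoc Rinv_l ?Rmult_1_r; last lra.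
apply: (Rmult_le_reg_r (Rpower 2 (INR l))); first exact: exp_pos.
apply: Rle_trans e_le.
apply: Rle_trans (_ : _ <= Rpower 2 (INR (b * l)%N - 9 * (INR b + INR l))
  * Rpower 2 (INR (b * l)%N + INR 8 * (INR b + log2 (INR l))) * Rpower 2 (INR l)) _.
  apply: Rmult_le_compat_r; first exact/Rlt_le/exp_pos.
  by apply: Rmult_le_compat_l upper; apply/Rlt_le/exp_pos.
rewrite -!Rpower_plus; apply: Rle_Rpower; first lra.
have := log2_le_INR l_gt0; have := pos_INR b; have := pos_INR l.
rewrite (_ : INR 8 = 8); last by rewrite /=; lra.
lra.
Qed.
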